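(* Let $n=6k+5$ with $k\ge 6$, and let $P(n,3)$ be the generalized Petersen graph with vertex set $\{u_1,\dots,u_n,v_1,\dots,v_n\}$ and edge set $\{u_iu_{i+1},\,u_iv_i,\,v_iv_{i+3}:1\le i\le n\}$ (subscripts modulo $n$). Then $\dim(P(n,3))\ge 4$.
   Context: For a connected graph $G$, an ordered set $W=\{w_1,\dots,w_m\}\subseteq V(G)$ is a resolving set if the vectors $r(z|W)=(d(z,w_1),\dots,d(z,w_m))$ of shortest-path distances are pairwise distinct over all $z\in V(G)$. The metric dimension $\dim(G)$ is the minimum cardinality of a resolving set of $G$. *)

(* Defs.v *)
From mathcomp Require Import all_boot.

Set Implicit Arguments.
Unset Strict Implicit.
Unset Printing Implicit Defensive.

(* A finite graph is given by its adjacency relation [e : rel T]. *)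

Section Distance.

Variables (T : finType) (e : rel T).

(* A walk is a vertex [x] followed by an [e]-path; its length is the number of
   vertices after [x]. *)
Definition has_walk (x y : T) (m : nat) : bool :=
  [exists p : m.-tuple T, path e x p && (last x p == y)].

(* A shortest walk repeats no vertex, so lengths below [#|T|] suffice
   (see [gdist_walk] and [gdist_min]); the value is the junk value [#|T|]
   only when no walk from [x] to [y] exists. *)
Definition gdist (x y : T) : nat :=
  \big[minn/#|T|]_(m < #|T| | has_walk x y m) m.

Definition distvec (W : seq T) (z : T) : seq nat := [seq gdist z w | w <- W].

(* An ordered set of vertices is a duplicate-free sequence. *)
Definition resolving (W : seq T) : bool := uniq W && injectiveb (distvec W).

(* The full vertex set is resolving (see [resolving_enum]), so this is a minimum
   over a nonempty set of cardinalities. *)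
Definition metric_dim : nat :=
  \big[minn/#|T|]_(m < #|T|.+1 | [exists W : m.-tuple T, resolving W]) m.

End Distance.

(* [inl i] is u_i and [inr i] is v_i; the indices 1..n modulo n are represented
   by their residues 0..n-1. *)
Definition petersen (n s : nat) : rel ('I_n + 'I_n) :=
  fun x y =>
    match x, y with
    | inl i, inl j => (j == i + 1 %[mod n]) || (i == j + 1 %[mod n])
    | inr i, inr j => (j == i + s %[mod n]) || (i == j + s %[mod n])
    | inl i, inr j => i == j
    | inr i, inl j => i == j
    end.
Arguments petersen n s : clear implicits.

Lemma bigminn_le (N d : nat) (P : pred nat) m :
  m < N -> P m -> \big[minn/d]_(i < N | P i) i <= m.
Proof.
move=> ltmN Pm; have := mem_index_enum (Ordinal ltmN).
elim: (index_enum _) => // i r IHr; rewrite inE big_cons.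
case/predU1P=> [<-|/IHr le_m] /=; first by rewrite Pm geq_minl.
by case: ifP => // _; rewrite geq_min le_m orbT.
Qed.

Lemma bigminn_mem (N d : nat) (P : pred nat) :
  let b := \big[minn/d]_(i < N | P i) i in b = d \/ b < N /\ P b.
Proof.
apply: (big_ind (fun b => b = d \/ b < N /\ P b)); first by left.
- by move=> a b Ha Hb; rewrite /minn; case: ifP.
- by move=> i Pi; right.
Qed.

Section DistanceTheory.

Variables (T : finType) (e : rel T).

Lemma has_walkP x y m :
  reflect (exists p, [/\ path e x p, last x p = y & size p = m])
          (has_walk e x y m).
Proof.
apply: (iffP existsP) => [[p /andP[ep /eqP lp]]|[p [ep lp sp]]].
  by exists p; rewrite size_tuple.
have sp' : size p == m by apply/eqP.
by exists (Tuple sp'); rewrite /= ep lp eqxx.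
Qed.

Lemma gdist_min x p : path e x p -> gdist e x (last x p) <= size p.
Proof.
move=> ep; case/shortenP: (ep) => q eq uq /uniq_leq_size sub.
have ltq : size q < #|T| by rewrite -[_.+1]/(size (x :: q)) -(card_uniqP uq) max_card.
apply: (@leq_trans (size q)); last by apply: sub; case/andP: uq.
by apply: (bigminn_le _ ltq); apply/has_walkP; exists q.
Qed.

Lemma gdist_walk x y :
  connect e x y ->
  exists p, [/\ path e x p, last x p = y & size p = gdist e x y].
Proof.
case/connectP=> p0 ep0 ->; apply/has_walkP.
case: (@bigminn_mem #|T| #|T| (has_walk e x (last x p0))) => [E|[]//].
case/shortenP: ep0 E => q eq uq _ E.
have ltq : size q < #|T| by rewrite -[_.+1]/(size (x :: q)) -(card_uniqP uq) max_card.
by move: (gdist_min eq); rewrite /gdist E leqNgt ltq.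
Qed.

Lemma gdist_eq0 x y : (gdist e x y == 0) = (x == y).
Proof.
apply/eqP/eqP => [d0|<-]; last first.
  by apply/eqP; rewrite -leqn0; apply: (@gdist_min x [::]).
have [E|[_ /has_walkP[p [_ lp]]]] := @bigminn_mem #|T| #|T| (has_walk e x y).
  have: 0 < #|T| by apply/card_gt0P; exists x.
  by rewrite -E -/(gdist e x y) d0.
by rewrite -/(gdist e x y) d0 => /size0nil p0; rewrite -lp p0.
Qed.

Lemma resolving_enum : resolving e (enum T).
Proof.
rewrite /resolving enum_uniq; apply/injectiveP => x y /eq_in_map E.
by apply/eqP; rewrite -gdist_eq0 E ?mem_enum // gdist_eq0.
Qed.

Lemma metric_dim_le W : resolving e W -> metric_dim e <= size W.
Proof.
move=> rW; have ltW : size W < #|T|.+1.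
  by case/andP: rW => /card_uniqP <- _; rewrite ltnS max_card.
apply: (@bigminn_le _ _ (fun m => [exists V : m.-tuple T, resolving e V]) _ ltW).
by apply/existsP; exists (in_tuple W).
Qed.

Lemma metric_dim_mem : exists2 W, resolving e W & size W = metric_dim e.
Proof.
case: (@bigminn_mem #|T|.+1 #|T|
  (fun m => [exists V : m.-tuple T, resolving e V])) => [E|[_ /existsP[W rW]]].
  by exists (enum T); [exact: resolving_enum | rewrite /metric_dim E -cardE].
by exists W; rewrite ?size_tuple.
Qed.

End DistanceTheory.

Lemma petersen_sym n s : symmetric (petersen n s).
Proof. by move=> [i|i] [j|j] //=; rewrite (eq_sym, orbC). Qed.

Lemma petersen_irr n s : 1 < n -> ~~ (n %| s) -> irreflexive (petersen n s).
Proof.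
move=> n1 ns [i|i] /=; rewrite orbb -{1}[i : nat]addn0 eqn_modDl mod0n.
  by rewrite modn_small.
by rewrite eq_sym; apply/negbTE.
Qed.

Lemma petersen_connect n s x y : connect (petersen n s) x y.
Proof.
have csym := @sym_connect_sym _ _ (@petersen_sym n s).
have spoke z : exists i : 'I_n, connect (petersen n s) z (inl i).
  by case: z => i; exists i => //; apply: connect1 => /=.
have rim (i j : 'I_n) : i <= j -> connect (petersen n s) (inl i) (inl j).
  case: j => j; elim: j => [|j IHj] ltj /=.
    by rewrite leqn0 => /eqP i0; rewrite (_ : i = Ordinal ltj) //; apply: val_inj.
  rewrite leq_eqVlt => /predU1P[ij|leij].
    by rewrite (_ : i = Ordinal ltj) //; apply: val_inj.
  apply: connect_trans (IHj (ltnW ltj) leij) (connect1 _).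
  by rewrite /= addn1 eqxx.
have [i ci] := spoke x; have [j cj] := spoke y.
apply: connect_trans ci _; rewrite csym; apply: connect_trans cj _.
by case/orP: (leq_total j i) => /rim //; rewrite csym.
Qed.

(* Main.v *)
Require Import Defs.
From mathcomp Require Import all_boot.
From mathcomp Require Import zify.

(* Going round the cycle in one direction from a vertex w, the distance to w of
   the vertex at offset p is p %/ 3 plus a term that depends only on p %% 3 and on
   the two sides (u or v), up to small exceptions; the distance is the minimum
   over the two directions.  For n = 2 mod 3 the vertices u_i and u_(i+2) are then
   equidistant from every w whose offset p from i satisfies 5 <= p <= n - 3 and
   p <> 2 mod 3.  Hence, inside an arc free of landmarks, i has to avoid one class
   mod 3 per landmark, which is possible unless the three classes are distinct.
   Crossing a landmark changes its class and no other, as n = 2 mod 3, so of two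
   adjacent arcs at least one has a coincidence.  If two of the three arcs between
   the landmarks have length at least 10, this yields two vertices with the same
   distances.  Otherwise the landmarks lie in a cluster of diameter at most 18
   with distinct residues mod 3; this leaves finitely many relative positions,
   all but two of which are dealt with by a pair of vertices near the cluster, and
   the last two by v_j and v_(j+1) opposite to it. *)

Set Implicit Arguments.
Unset Strict Implicit.
Unset Printing Implicit Defensive.

(** * Distances in P(n,3) *)

(** Descending along [F] gives a walk of length at most [F x]; since an edge lowers [F] by at most
    one, no walk to [w] is shorter. *)
Lemma gdist_unique (T : finType) (e : rel T) (w : T) (F : T -> nat) :
  F w = 0 ->
  (forall x y, e x y -> F x <= (F y).+1) ->
  (forall x, x != w -> exists2 y, e x y & F y < F x) ->
  forall x, gdist e x w = F x.
Proof.
move=> Fw Flip Fdesc.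
have up m x : F x <= m -> exists p, [/\ path e x p, last x p = w & size p <= m].
  elim: m x => [|m IHm] x Fx; have [->|/Fdesc[y exy ltF]] := eqVneq x w;
    try by exists [::].
    by move: ltF; rewrite ltnNge (leq_trans Fx).
  have [|p [ep lp sp]] := IHm y; first by rewrite -ltnS (leq_trans ltF).
  by exists (y :: p); rewrite /= exy.
move=> x; have [p [ep lp sp]] := up _ x (leqnn _).
apply/eqP; rewrite eqn_leq; apply/andP; split.
  by apply: leq_trans sp; rewrite -lp gdist_min.
have cxw : connect e x w by apply/connectP; exists p.
have [q [eq lq <-]] := gdist_walk cxw.
elim: q x eq lq {p ep lp sp cxw} => [|y q IHq] x /=; first by move=> _ ->; rewrite Fw.
by case/andP=> /Flip Fx /IHq Hy /Hy Fy; apply: leq_trans Fx _.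
Qed.

(* [true] stands for the inner vertices v, [false] for the outer vertices u.  This
   is the length of a shortest walk in one direction between vertices at offset
   [p]: p %/ 3 inner steps, p %% 3 outer steps, and the spokes needed. *)
Definition oneway (t s : bool) (p : nat) : nat :=
  p %/ 3 + p %% 3 +
  if t == s then ((if t then p %% 3 != 0 else 2 < p) : nat).*2 else 1.

Definition cycdist (n : nat) (t s : bool) (p : nat) : nat :=
  minn (oneway t s (p %% n)) (oneway t s (n - p %% n)).

Lemma oneway_outer s p : oneway false s p <= (oneway false s p.+1).+1 /\
   oneway false s p.+1 <= (oneway false s p).+1.
Proof. by rewrite /oneway; case: s => /=; lia. Qed.

Lemma oneway_inner s p : oneway true s (p + 3) = (oneway true s p).+1.
Proof. by rewrite /oneway; case: s => /=; lia. Qed.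

Lemma oneway_spoke t s p : oneway t s p <= (oneway (~~ t) s p).+1.
Proof. by rewrite /oneway; case: s t => [] [] /=; lia. Qed.

(** The three cases are the first move of a shortest one-way walk: none, a spoke, or a step forward
    on the same side. *)
Lemma oneway_desc t s p : (t == s) && (p == 0) || (oneway (~~ t) s p < oneway t s p)
  || (if t then (2 < p) && (oneway true s (p - 3) < oneway true s p)
   else (0 < p) && (oneway false s (p - 1) < oneway false s p)).
Proof. by rewrite /oneway; case: s t => [] [] /=; lia. Qed.

Lemma cycdist_congr n t s p q : p = q %[mod n] -> cycdist n t s p = cycdist n t s q.
Proof. by rewrite /cycdist => ->. Qed.

Lemma cycdistE n t s p : p <= n ->
  cycdist n t s p = minn (oneway t s p) (oneway t s (n - p)).
Proof.
rewrite /cycdist leq_eqVlt => /predU1P[->|/modn_small-> //].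
by rewrite modnn subn0 subnn minnC.
Qed.

Lemma cycdist_sym n t s p : p <= n -> cycdist n t s (n - p) = cycdist n t s p.
Proof. by move=> lepn; rewrite !cycdistE ?leq_subr // subKn // minnC. Qed.

Lemma cycdist_outer n s p : 0 < n ->
  cycdist n false s p <= (cycdist n false s p.+1).+1 /\
  cycdist n false s p.+1 <= (cycdist n false s p).+1.
Proof.
move=> n_gt0; rewrite -(@cycdist_congr n _ _ (p %% n)) ?modn_mod //.
rewrite -(@cycdist_congr n _ _ (p %% n).+1 p.+1); last by rewrite -addn1 modnDml addn1.
have ltpn := ltn_pmod p n_gt0; move: (p %% n) ltpn => r ltrn.
rewrite !cycdistE //; last by lia.
have := oneway_outer s r; have := oneway_outer s (n - r.+1).
by rewrite subnSK //; lia.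
Qed.

Lemma cycdist_inner n s p : 20 <= n ->
  cycdist n true s p <= (cycdist n true s (p + 3)).+1 /\
  cycdist n true s (p + 3) <= (cycdist n true s p).+1.
Proof.
move=> len; rewrite -(@cycdist_congr n _ _ (p %% n)) ?modn_mod //.
rewrite -(@cycdist_congr n _ _ (p %% n + 3) (p + 3)); last by rewrite modnDml.
have ltpn : p %% n < n by rewrite ltn_pmod //; lia.
move: (p %% n) ltpn => r ltrn.
have [ler|ltr] := leqP (r + 3) n.
  rewrite !cycdistE //; last by lia.
  have := oneway_inner s r; have := oneway_inner s (n - (r + 3)).
  by rewrite (_ : n - (r + 3) + 3 = n - r); lia.
(* The step jumps over offset 0, so its ends lie on opposite sides of it, at distances 1 and 2 in
   some order. *)
rewrite -(@cycdist_sym n _ _ r); last by lia.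
rewrite -(@cycdist_congr n _ _ (r + 3 - n) (r + 3)); last first.
  by rewrite -[r + 3 in RHS](subnK (ltnW ltr)) modnDr.
have [[-> ->]|[-> ->]] : n - r = 1 /\ r + 3 - n = 2 \/ n - r = 2 /\ r + 3 - n = 1.
  by lia.
all: rewrite !cycdistE; try lia.
all: by rewrite /oneway; case: s => /=; lia.
Qed.

Lemma cycdist_spoke n t s p : cycdist n t s p <= (cycdist n (~~ t) s p).+1.
Proof.
rewrite /cycdist; have := oneway_spoke t s (p %% n).
by have := oneway_spoke t s (n - p %% n); lia.
Qed.

Definition vtx m (t : bool) (p : nat) : 'I_m.+1 + 'I_m.+1 :=
  let i := Ordinal (ltn_pmod p (ltn0Sn m)) in if t then inr i else inl i.

Definition vtype m (z : 'I_m.+1 + 'I_m.+1) : bool := if z is inr _ then true else false.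

Definition vpos m (z : 'I_m.+1 + 'I_m.+1) : nat :=
  match z with inl i => i | inr i => i end.

(** Adding [m.+1 - vpos w] subtracts [vpos w] modulo [m.+1] without truncation. *)
Definition potential m (w z : 'I_m.+1 + 'I_m.+1) :=
  cycdist m.+1 (vtype z) (vtype w) (vpos z + (m.+1 - vpos w)).

Lemma potential_lip m (w x y : 'I_m.+1 + 'I_m.+1) : 20 <= m.+1 ->
  petersen m.+1 3 x y -> potential w x <= (potential w y).+1.
Proof.
move=> lem; rewrite /potential; move: (m.+1 - vpos w) (vtype w) => c s.
case: x y => [i|i] [j|j] /=.
- case/orP=> /eqP E.
    rewrite (@cycdist_congr _ _ _ (j + c) (i + c).+1); last first.
      by rewrite -modnDml E modnDml addn1 addSn.
    by have [] := @cycdist_outer m.+1 s (i + c).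
  rewrite (@cycdist_congr _ _ _ (i + c) (j + c).+1); last first.
    by rewrite -modnDml E modnDml addn1 addSn.
  by have [] := @cycdist_outer m.+1 s (j + c).
- by move/eqP->; apply: cycdist_spoke.
- by move/eqP->; apply: cycdist_spoke.
case/orP=> /eqP E.
  rewrite (@cycdist_congr _ _ _ (j + c) (i + c + 3)); last first.
    by rewrite -modnDml E modnDml addnAC.
  by have [] := @cycdist_inner m.+1 s (i + c) lem.
rewrite (@cycdist_congr _ _ _ (i + c) (j + c + 3)); last first.
  by rewrite -modnDml E modnDml addnAC.
by have [] := @cycdist_inner m.+1 s (j + c) lem.
Qed.

Lemma potential_vtx m w t p :
  potential w (vtx m t p) = cycdist m.+1 t (vtype w) (p + (m.+1 - vpos w)).
Proof.
rewrite /potential (_ : vtype _ = t); last by case: t.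
rewrite (_ : vpos _ = p %% m.+1); last by case: t.
by apply: cycdist_congr; rewrite modnDml.
Qed.

Lemma vtxK m (z : 'I_m.+1 + 'I_m.+1) : vtx m (vtype z) (vpos z) = z.
Proof.
by case: z => i; rewrite /vtx /=; congr (_ _); apply: val_inj; rewrite /= modn_small.
Qed.

Lemma vtx_congr m t p q : p = q %[mod m.+1] -> vtx m t p = vtx m t q.
Proof. by move=> E; rewrite /vtx; case: t; congr (_ _); apply: val_inj. Qed.

Lemma petersen_vtx_spoke m t p : petersen m.+1 3 (vtx m t p) (vtx m (~~ t) p).
Proof. by case: t => /=. Qed.

Lemma petersen_vtx_step m (t : bool) p :
  petersen m.+1 3 (vtx m t p) (vtx m t (p + if t then 3 else 1)).
Proof. by case: t => /=; rewrite modn_mod modnDml eqxx. Qed.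

Lemma potential_desc m (w x : 'I_m.+1 + 'I_m.+1) : 20 <= m.+1 ->
  x != w -> exists2 y, petersen m.+1 3 x y & potential w y < potential w x.
Proof.
move=> lem neq; set t := vtype x; set s := vtype w; set n := m.+1.
have ltw : vpos w < n by case: (w) => i /=; exact: ltn_ord.
have ltx : vpos x < n by case: (x) => i /=; exact: ltn_ord.
pose o := (vpos x + (n - vpos w)) %% n.
have lto : o < n by rewrite ltn_pmod.
have ox : vpos x = vpos w + o %[mod n].
  by rewrite modnDmr addnCA subnKC ?modnDr // ltnW.
have -> : x = vtx m t (vpos w + o) by rewrite -(vtx_congr _ ox) vtxK.
have pot t' r : potential w (vtx m t' (vpos w + r)) = cycdist n t' s r.
  rewrite potential_vtx; apply: cycdist_congr.
  by rewrite addnAC subnKC ?modnDl // ltnW.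
have nz : ~~ ((t == s) && (o == 0)).
  apply: contra neq => /andP[/eqP ts /eqP o0].
  by rewrite -(vtxK x) -/t ts (vtx_congr _ ox) o0 addn0 vtxK.
have nz' : ~~ ((t == s) && (n - o == 0)) by rewrite negb_and orbC subn_eq0 -ltnNge lto.
have leo := ltnW lto; rewrite pot (cycdistE _ _ leo).
have D1 := oneway_desc t s o; have D2 := oneway_desc t s (n - o).
(* Move in a direction attaining the minimum: lowering that term lowers [cycdist]. *)
have [le12|lt21] := leqP (oneway t s o) (oneway t s (n - o)).
  move: D1; rewrite (negbTE nz) /= => /orP[lt|].
    exists (vtx m (~~ t) (vpos w + o)); first exact: petersen_vtx_spoke.
    by rewrite pot (cycdistE _ _ leo) gtn_min lt.
  move=> D1; pose h := if t then 3 else 1.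
  have [leh lt] : h <= o /\ oneway t s (o - h) < oneway t s o.
    by rewrite /h; case: (t) D1 => /andP[].
  exists (vtx m t (vpos w + (o - h))).
    by rewrite petersen_sym -{2}(subnK leh) addnA petersen_vtx_step.
  by rewrite pot (cycdistE _ _ (leq_trans (leq_subr _ _) leo)) gtn_min lt.
move: D2; rewrite (negbTE nz') /= => /orP[lt|].
  exists (vtx m (~~ t) (vpos w + o)); first exact: petersen_vtx_spoke.
  by rewrite pot (cycdistE _ _ leo) gtn_min lt orbT.
move=> D2; pose h := if t then 3 else 1.
have [leh lt] : h <= n - o /\ oneway t s (n - o - h) < oneway t s (n - o).
  by rewrite /h; case: (t) D2 => /andP[].
exists (vtx m t (vpos w + (o + h))); first by rewrite addnA petersen_vtx_step.
rewrite pot cycdistE; last by rewrite -leq_subRL.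
by rewrite gtn_min subnDA lt orbT.
Qed.

Lemma gdist_petersen3 m (w z : 'I_m.+1 + 'I_m.+1) : 20 <= m.+1 ->
  gdist (petersen m.+1 3) z w = potential w z.
Proof.
move=> lem; apply: gdist_unique.
- rewrite /potential (@cycdist_congr _ _ _ _ 0); last first.
    by rewrite subnKC ?modnn ?mod0n //; case: (w) => i /=; exact: ltnW.
  by rewrite cycdistE // /oneway eqxx; case: (vtype w); rewrite min0n.
- by move=> x y; apply: potential_lip.
- by move=> x; apply: potential_desc.
Qed.

Lemma gdist_vtx m t s p q : 20 <= m.+1 -> q <= p <= q + m.+1 ->
  gdist (petersen m.+1 3) (vtx m t p) (vtx m s q) =
    minn (oneway t s (p - q)) (oneway t s (m.+1 - (p - q))).
Proof.
move=> lem /andP[leqp lepq]; rewrite gdist_petersen3 // potential_vtx.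
rewrite (_ : vtype _ = s); last by case: s.
rewrite (_ : vpos _ = q %% m.+1); last by case: s.
rewrite (@cycdist_congr _ _ _ _ (p - q)) ?cycdistE //; try by lia.
have -> : p + (m.+1 - q %% m.+1) = (q %/ m.+1).+1 * m.+1 + (p - q).
  rewrite mulSn; have := divn_eq q m.+1; have := ltn_pmod q (ltn0Sn m).
  by move: (q %/ _ * _) (q %% _); lia.
by rewrite modnMDl.
Qed.

Lemma gdist_vtx_le m t s p q : 20 <= m.+1 -> p <= q <= p + m.+1 ->
  gdist (petersen m.+1 3) (vtx m t p) (vtx m s q) =
    minn (oneway t s (q - p)) (oneway t s (m.+1 - (q - p))).
Proof.
move=> lem /andP[lepq leqp].
rewrite (@vtx_congr _ t p (p + m.+1)); last by rewrite modnDr.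
rewrite gdist_vtx //; last by lia.
by rewrite minnC (_ : m.+1 - _ = q - p) 1?(_ : p + m.+1 - q = m.+1 - (q - p)); lia.
Qed.

(** For offsets up to 9 the other way round is too long to matter, so the distance does not depend
    on [m]. *)
Lemma gdist_vtx_near m t s p q : 41 <= m.+1 -> p <= q + 9 -> q <= p + 9 ->
  gdist (petersen m.+1 3) (vtx m t p) (vtx m s q) = oneway t s ((p - q) + (q - p)).
Proof.
move=> lem lepq leqp; have [leqp'|ltpq] := leqP q p.
  rewrite gdist_vtx; [rewrite (_ : q - p = 0) ?addn0 | |]; try lia.
  by rewrite /oneway; case: t s => [] [] /=; lia.
rewrite gdist_vtx_le; [rewrite (_ : p - q = 0) ?add0n | |]; try lia.
by rewrite /oneway; case: t s => [] [] /=; lia.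
Qed.

Lemma vtx_neq m t s p q : p <= q < p + m.+1 -> (t != s) || (p < q) ->
  vtx m t p != vtx m s q.
Proof.
move=> /andP[lepq ltq] /orP[ts|ltpq].
  by case: t s ts => [] [].
have E : ~~ (p == q %[mod m.+1]).
  rewrite eq_sym eqn_mod_dvd //; apply/negP => /dvdn_leq.
  by rewrite subn_gt0 => /(_ ltpq); lia.
by apply: contra E => /eqP; rewrite /vtx; case: t s => [] [] // [->].
Qed.

(** * Unresolved pairs inside an arc and near a cluster *)

(** Only membership in [W] counts, so landmarks may be repeated, reordered or padded. *)
Definition confusable (T : finType) (e : rel T) (W : seq T) :=
  exists z z', z != z' /\ {in W, forall w, gdist e z w = gdist e z' w}.

Lemma confusable_sub (T : finType) (e : rel T) (W W' : seq T) :
  {subset W <= W'} -> confusable e W' -> confusable e W.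
Proof. by move=> sWW' [z [z' [neq H]]]; exists z, z'; split=> // w /sWW'/H. Qed.

Lemma resolving_unconfusable (T : finType) (e : rel T) (W : seq T) :
  resolving e W -> ~ confusable e W.
Proof.
case/andP=> _ /injectiveP inj [z [z' [/eqP neq H]]].
by apply: neq; apply: inj; apply/eq_in_map.
Qed.

(** Lengthening an offset that is not 0 mod 3 by 2 raises its quotient by 3 by one and lowers its
    remainder by one, which keeps [oneway] constant once the spokes are paid. *)
Lemma gdist_outer_pair m s i p : 20 <= m.+1 -> m.+1 %% 3 = 2 ->
  i + 5 <= p -> p + 3 <= i + m.+1 ->
  p %% 3 != (i + 2) %% 3 ->
  gdist (petersen m.+1 3) (vtx m false i) (vtx m s p) =
  gdist (petersen m.+1 3) (vtx m false (i + 2)) (vtx m s p).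
Proof.
move=> lem n3 lep gep neq; rewrite !gdist_vtx_le; try lia.
move: (m.+1) lem n3 gep => n lem n3 gep.
have -> : p - i = p - (i + 2) + 2 by lia.
have -> : n - (p - (i + 2)) = n - (p - (i + 2) + 2) + 2 by lia.
have : (p - (i + 2)) %% 3 != 0 by lia.
have : 3 <= p - (i + 2) by lia.
have : 3 <= n - (p - (i + 2) + 2) by lia.
(* As n = 2 mod 3, the two shorter offsets are opposite mod 3, so one residue condition serves both
   directions. *)
have : (n - (p - (i + 2) + 2)) %% 3 + (p - (i + 2)) %% 3 = 0 %[mod 3] by lia.
move: (_ - _) (n - _) => x y E gex gey nx.
by congr minn; rewrite /oneway; case: s => /=; lia.
Qed.

Lemma confusable_outer_pair m a b c ta tb tc i : 20 <= m.+1 -> m.+1 %% 3 = 2 ->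
  all (fun p => [&& i + 5 <= p, p + 3 <= i + m.+1 & p %% 3 != (i + 2) %% 3])
    [:: a; b; c] ->
  confusable (petersen m.+1 3) [:: vtx m ta a; vtx m tb b; vtx m tc c].
Proof.
move=> lem n3 /and4P[/and3P[a1 a2 a3] /and3P[b1 b2 b3] /and3P[c1 c2 c3] _].
exists (vtx m false i), (vtx m false (i + 2)); split.
  by apply: vtx_neq; lia.
by move=> w; rewrite !inE => /or3P[]/eqP->; apply: gdist_outer_pair.
Qed.

(* Found by a computer search. *)
Definition near_pairs : seq ((bool * nat) * (bool * nat)) :=
  [:: ((false, 0), (false, 2)); ((false, 1), (true, 0)); ((false, 3), (true, 0));
      ((false, 0), (false, 4)); ((true, 0), (true, 6)); ((false, 0), (true, 1));
      ((false, 0), (true, 5)); ((false, 5), (true, 0));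
      ((true, 0), (true, 2))].

Definition local_dist (x y : bool * nat) : nat :=
  oneway x.1 y.1 ((x.2 - y.2) + (y.2 - x.2)).

Definition shift i (x : bool * nat) := (x.1, i + x.2).

(* [if] rather than [&&], whose second argument would always be evaluated. *)
Definition near_confused (W : seq (bool * nat)) (z : (bool * nat) * (bool * nat)) i :=
  let x := shift i z.1 in let y := shift i z.2 in
  all (fun w => if [&& x.2 <= w.2 + 9, w.2 <= x.2 + 9, y.2 <= w.2 + 9 &
    w.2 <= y.2 + 9] then local_dist x w == local_dist y w else false) W.

(* The configurations u_a, v_(a+1), v_(a+5) and, by reflection, v_a, v_(a+4),
   u_(a+5): no pair of vertices near them is unresolved. *)
Definition antipodal_case (ta tb tc : bool) g h :=
  ([&& g == 1, h == 4, ~~ ta, tb & tc]) || ([&& g == 4, h == 1, ta, tb & ~~ tc]).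

(** The cluster starts at 9 to leave room for a pair before it; [i >= g + h] keeps the last
    landmark, at [9 + (g + h)], at most 9 beyond [i]. *)
Definition cluster_check : bool :=
  let types := [:: false; true] in
  all (fun g => all (fun h =>
    if uniq [:: 0; g %% 3; (g + h) %% 3] then
      all (fun ta => all (fun tb => all (fun tc =>
        if antipodal_case ta tb tc g h then true else
        let W := [:: (ta, 9); (tb, 9 + g); (tc, 9 + (g + h))] in
        has (fun z => has (near_confused W z) (iota (g + h) (18 - (g + h)))) near_pairs)
      types) types) types
    else true) (iota 0 10)) (iota 0 10).

Lemma cluster_checked : cluster_check.
Proof. by vm_compute. Qed.

(** Distances between close vertices are invariant under the translation by [d], so the finite check
    transfers. *)
Lemma near_confusedP m d W z i : 41 <= m.+1 -> near_confused W z i -> z \in near_pairs ->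
  confusable (petersen m.+1 3) [seq vtx m w.1 (d + w.2) | w <- W].
Proof.
move=> lem /allP H zin.
exists (vtx m z.1.1 (d + (i + z.1.2))), (vtx m z.2.1 (d + (i + z.2.2))); split.
  have: [&& z.1.2 <= 6, z.2.2 <= 6 & (z.1.1 != z.2.1) || (z.1.2 < z.2.2)].
    by move: z zin {H}; apply/allP.
  case/and3P=> z1 z2 neq; have [le12|lt21] := leqP z.1.2 z.2.2.
    by apply: vtx_neq; lia.
  by rewrite eq_sym; apply: vtx_neq; lia.
move=> _ /mapP[w /H + ->]; case: ifP => // /and4P[/= l1 l2 l3 l4] /eqP E.
rewrite !gdist_vtx_near; try lia.
by move: E; rewrite /local_dist /= !subnDl.
Qed.

Lemma confusable_cluster m a g h ta tb tc : 41 <= m.+1 -> 9 <= a ->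
  g < 10 -> h < 10 -> uniq [:: 0; g %% 3; (g + h) %% 3] ->
  ~~ antipodal_case ta tb tc g h ->
  confusable (petersen m.+1 3) [:: vtx m ta a; vtx m tb (a + g); vtx m tc (a + (g + h))].
Proof.
move=> lem lea ltg lth u nh.
have bl (t : bool) : t \in [:: false; true] by case: t.
have := cluster_checked; move/allP => /(_ g); rewrite mem_iota => /(_ ltg).
move/allP => /(_ h); rewrite mem_iota => /(_ lth); rewrite u.
move/allP => /(_ ta (bl _)) /allP /(_ tb (bl _)) /allP /(_ tc (bl _)).
rewrite (negbTE nh) => /hasP[z zin /hasP[i _ H]].
have := near_confusedP (a - 9) lem H zin; rewrite /= !addnA !subnK //.
Qed.

(** * The two exceptional configurations *)

Lemma oneway_innerM s j p : oneway true s (3 * j + p) = j + oneway true s p.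
Proof.
elim: j => [|j IHj]; first by rewrite muln0.
by rewrite (_ : 3 * j.+1 + p = 3 * j + p + 3) ?oneway_inner ?IHj //; lia.
Qed.

(** Both directions contain [k] full inner steps; removing them leaves a quantity independent of
    [k], which can be computed. *)
Lemma gdist_antipode m k s a r j : m.+1 = 6 * k.+1 + 5 -> 5 <= k ->
  j <= r + 3 -> r <= j + 8 -> j <= 5 ->
  gdist (petersen m.+1 3) (vtx m true (a + (3 * k.+1 + r))) (vtx m s (a + j)) =
    k + minn (oneway true s (r + 3 - j)) (oneway true s (8 + j - r)).
Proof.
move=> Em lek lej ler lej5; rewrite gdist_vtx; try lia.
have -> : a + (3 * k.+1 + r) - (a + j) = 3 * k + (r + 3 - j) by lia.
have -> : m.+1 - (3 * k + (r + 3 - j)) = 3 * k + (8 + j - r) by lia.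
by rewrite !oneway_innerM addn_minr.
Qed.

Lemma confusable_antipodal m k a g h ta tb tc : m.+1 = 6 * k + 5 -> 6 <= k ->
  antipodal_case ta tb tc g h ->
  confusable (petersen m.+1 3) [:: vtx m ta a; vtx m tb (a + g); vtx m tc (a + (g + h))].
Proof.
case: k => // k Em lek H.
have -> : vtx m ta a = vtx m ta (a + 0) by rewrite addn0.
have [r [ler E]] : exists r, 3 <= r <= 7 /\
    forall w, w \in [:: (ta, 0); (tb, g); (tc, g + h)] ->
    w.2 <= 5 /\ minn (oneway true w.1 (r + 3 - w.2)) (oneway true w.1 (8 + w.2 - r)) =
    minn (oneway true w.1 (r.+1 + 3 - w.2)) (oneway true w.1 (8 + w.2 - r.+1)).
  case/orP: H => /and5P[/eqP-> /eqP-> ta0 tb0 tc0].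
    exists 3; split=> // w; rewrite (negbTE ta0) tb0 tc0 !inE.
    by case/or3P=> /eqP->.
  (* The reflection exchanging offsets 0 and 5 carries the pair for 3, 4 to the one for 7, 6. *)
  exists 6; split=> // w; rewrite (negbTE tc0) tb0 ta0 !inE.
  by case/or3P=> /eqP->.
exists (vtx m true (a + (3 * k.+1 + r))), (vtx m true (a + (3 * k.+1 + r.+1))); split.
  by apply: vtx_neq; lia.
move=> w /(@mapP _ _ (fun w => vtx m w.1 (a + w.2)) [:: (ta, 0); (tb, g); (tc, g + h)]).
case=> {}w /E[l5 Ew] ->.
rewrite !gdist_antipode ?Ew //; lia.
Qed.

(** * Arcs between landmarks and residues mod 3 *)

Lemma avoid_residues s p q :
  exists2 i, s <= i <= s + 2 & (p %% 3 != (i + 2) %% 3) && (q %% 3 != (i + 2) %% 3).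
Proof.
have : [|| (p %% 3 != (s + 2) %% 3) && (q %% 3 != (s + 2) %% 3),
  (p %% 3 != (s + 1 + 2) %% 3) && (q %% 3 != (s + 1 + 2) %% 3) |
  (p %% 3 != (s + 2 + 2) %% 3) && (q %% 3 != (s + 2 + 2) %% 3)] by lia.
by case/or3P=> H; [exists s | exists (s + 1) | exists (s + 2)] => //; lia.
Qed.

(** A repeated residue leaves only two classes to avoid, so one of three consecutive [i] works;
    [s + 7] is [i + 5] for the largest, [i = s + 2]. *)
Lemma confusable_window m s a b c ta tb tc : 20 <= m.+1 -> m.+1 %% 3 = 2 ->
  all (fun p => (s + 7 <= p) && (p + 3 <= s + m.+1)) [:: a; b; c] ->
  ~~ uniq [:: a %% 3; b %% 3; c %% 3] ->
  confusable (petersen m.+1 3) [:: vtx m ta a; vtx m tb b; vtx m tc c].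
Proof.
move=> lem n3 /and4P[/andP[a1 a2] /andP[b1 b2] /andP[c1 c2] _].
rewrite /= !inE negb_and negbK andbT negbK -orbA => /or3P E.
have [i ilt] : exists2 i, s <= i <= s + 2 & [&& a %% 3 != (i + 2) %% 3,
    b %% 3 != (i + 2) %% 3 & c %% 3 != (i + 2) %% 3].
  case: E => /eqP E;
    [have [i ? /andP[? ?]] := avoid_residues s a c
    | have [i ? /andP[? ?]] := avoid_residues s a b | have [i ? /andP[? ?]] := avoid_residues s a b];
    by exists i; rewrite // -E; apply/and3P.
case/and3P=> Ha Hb Hc; apply: (@confusable_outer_pair _ _ _ _ _ _ _ i) => //=.
by rewrite Ha Hb Hc !andbT; lia.
Qed.

Lemma confusable_gap m k a b c ta tb tc : m.+1 = 6 * k + 5 -> 6 <= k ->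
  a <= b <= c -> c + 14 <= a + m.+1 ->
  confusable (petersen m.+1 3) [:: vtx m ta a; vtx m tb b; vtx m tc c].
Proof.
move=> Em lek leabc gap.
have wrap t p : vtx m t p = vtx m t (p + m.+1) by apply: vtx_congr; rewrite modnDr.
(* This keeps [a - 7] and [a - 9] below from truncating. *)
wlog lea : a b c leabc gap / 9 <= a.
  move=> H; have := H (a + m.+1) (b + m.+1) (c + m.+1).
  by rewrite -!wrap; apply; lia.
have le20 : 20 <= m.+1 by lia.
have n3 : m.+1 %% 3 = 2 by lia.
have [u|nu] := boolP (uniq [:: a %% 3; b %% 3; c %% 3]); last first.
  by apply: (@confusable_window _ (a - 7)) => //=; lia.
move: u; rewrite /= !inE => u.
(* The residues now fill all classes. Going once round adds 2 to a residue, so moving [a], or both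
   [a] and [b], past [c] creates a coincidence. *)
have [lth|leh] := ltnP (c - b) 10; last first.
  rewrite (wrap ta) (wrap tb); apply: (@confusable_window _ (c - 7)) => //=; first lia.
  by rewrite !inE; lia.
have [ltg|leg] := ltnP (b - a) 10; last first.
  rewrite (wrap ta); apply: (@confusable_window _ (b - 7)) => //=; first lia.
  by rewrite !inE; lia.
have -> : b = a + (b - a) by lia.
have -> : c = a + ((b - a) + (c - b)) by lia.
have [hd|nhd] := boolP (antipodal_case ta tb tc (b - a) (c - b)).
  exact: confusable_antipodal Em lek hd.
apply: confusable_cluster => //; first by lia.
by rewrite /= !inE; lia.
Qed.

Lemma confusable3 m k w1 w2 w3 : m.+1 = 6 * k + 5 -> 6 <= k ->
  confusable (petersen m.+1 3) [:: w1; w2; w3].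
Proof.
move=> Em lek; set W := [:: w1; w2; w3].
pose leW (x y : 'I_m.+1 + 'I_m.+1) := vpos x <= vpos y.
have sW : sorted leW (sort leW W) by apply: sort_sorted => x y; apply: leq_total.
have eW : sort leW W =i W by apply: mem_sort.
have zW : size (sort leW W) = 3 by rewrite size_sort.
case: (sort leW W) sW eW zW => [|x [|y [|z [|? ?]]]] //=.
rewrite andbT => /andP[lexy leyz] eW _.
have ltz : vpos z < m.+1 by case: (z) => i /=; exact: ltn_ord.
have wrap w : w = vtx m (vtype w) (vpos w + m.+1).
  by rewrite -{1}(vtxK w); apply: vtx_congr; rewrite modnDr.
have sub (W' : seq _) : {subset [:: x; y; z] <= W'} ->
    confusable (petersen m.+1 3) W' -> confusable (petersen m.+1 3) W.
  by move=> H; apply: confusable_sub => w; rewrite -eW => /H.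
rewrite /leW in lexy leyz.
(* Three arcs of length at most 13 cover only 39, while [m.+1] is at least 41. *)
have : [|| vpos z + 14 <= vpos x + m.+1, vpos x + m.+1 + 14 <= vpos y + m.+1 |
  vpos y + m.+1 + 14 <= vpos z + m.+1] by lia.
case/or3P=> gap.
- apply: sub (@confusable_gap m k (vpos x) (vpos y) (vpos z)
    (vtype x) (vtype y) (vtype z) Em lek _ gap); last by rewrite lexy.
  by rewrite !vtxK.
- apply: sub (@confusable_gap m k (vpos y) (vpos z) (vpos x + m.+1)
    (vtype y) (vtype z) (vtype x) Em lek _ gap); last by lia.
  by rewrite !vtxK -wrap => w; rewrite !inE; case/or3P=> ->; rewrite ?orbT.
apply: sub (@confusable_gap m k (vpos z) (vpos x + m.+1) (vpos y + m.+1)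
  (vtype z) (vtype x) (vtype y) Em lek _ gap); last by lia.
by rewrite !vtxK -!wrap => w; rewrite !inE; case/or3P=> ->; rewrite ?orbT.
Qed.

Theorem theorem3 (n k : nat) (hn : n = 6 * k + 5) (hk : 6 <= k) :
  4 <= metric_dim (petersen n 3).
Proof.
case: n hn => [|m] hn; first by lia.
have [W rW <-] := metric_dim_mem (petersen m.+1 3).
rewrite leqNgt; apply/negP => ltW.
pose w0 : 'I_m.+1 + 'I_m.+1 := inl ord0.
apply: (resolving_unconfusable rW).
(* The default [w0] of [nth] pads [W] to three landmarks. *)
apply: confusable_sub (confusable3 (nth w0 W 0) (nth w0 W 1) (nth w0 W 2) hn hk).
case: W ltW {rW} => [|x [|y [|z [|? ?]]]] //= _ w; rewrite !inE.
- by move->.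
- by case/orP=> ->; rewrite ?orbT.
by [].
Qed.
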